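(* $BR_5(K_{2,2},K_{4,4})=26$.
   Context: For bipartite graphs $H_1,H_2$ and a positive integer $m$, $BR_m(H_1,H_2)$ is the least positive integer $n$ such that for every subgraph $G$ of $K_{m,n}$ (parts of sizes $m$ and $n$), either $G$ contains a copy of $H_1$ or the bipartite complement $\overline{G}=K_{m,n}-E(G)$ contains a copy of $H_2$. *)

(* Defs.v *)
From mathcomp Require Import all_boot.
Set Implicit Arguments.
Unset Strict Implicit.
Unset Printing Implicit Defensive.

Record sgraph := SGraph {
  vertex : finType;
  adj : rel vertex;
  adj_sym : symmetric adj;
  adj_irrefl : irreflexive adj }.

(* A copy need not be induced. *)
Definition contains_copy (G H : sgraph) : Prop :=
  exists2 f : vertex H -> vertex G,
    injective f & forall x y, adj x y -> adj (f x) (f y).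

Definition Kbip_adj (m n : nat) : rel ('I_m + 'I_n)%type :=
  fun x y => match x, y with
             | inl _, inr _ | inr _, inl _ => true
             | _, _ => false
             end.

Lemma Kbip_adj_sym m n : symmetric (@Kbip_adj m n).
Proof. by case=> ? [] ?. Qed.

Lemma Kbip_adj_irrefl m n : irreflexive (@Kbip_adj m n).
Proof. by case. Qed.

Definition Kbip (m n : nat) : sgraph :=
  SGraph (@Kbip_adj_sym m n) (@Kbip_adj_irrefl m n).

(* Subgraphs are taken spanning, so that the complement below lives on the
   same vertices: a subgraph amounts to a set of edges of K. *)
Record subgraph (K : sgraph) := Subgraph {
  sub_adj : rel (vertex K);
  sub_adj_sym : symmetric sub_adj;
  sub_adjW : subrel sub_adj (@adj K) }.

Lemma sub_adj_irrefl K (G : subgraph K) : irreflexive (sub_adj G).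
Proof.
by move=> x; apply/negP => /(@sub_adjW _ G); rewrite adj_irrefl.
Qed.

Definition sgraph_of_subgraph K (G : subgraph K) : sgraph :=
  SGraph (@sub_adj_sym K G) (@sub_adj_irrefl K G).

Coercion sgraph_of_subgraph : subgraph >-> sgraph.

Definition compl_adj K (G : subgraph K) : rel (vertex K) :=
  fun x y => adj x y && ~~ sub_adj G x y.

Lemma compl_adj_sym K (G : subgraph K) : symmetric (compl_adj G).
Proof. by move=> x y; rewrite /compl_adj adj_sym sub_adj_sym. Qed.

Lemma compl_adjW K (G : subgraph K) : subrel (compl_adj G) (@adj K).
Proof. by move=> x y /andP[]. Qed.

(* K - E(G); the bipartite complement of G when K = Kbip m n. *)
Definition rel_compl K (G : subgraph K) : subgraph K :=
  Subgraph (@compl_adj_sym K G) (@compl_adjW K G).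

Definition BR_arrows (m : nat) (H1 H2 : sgraph) (n : nat) : Prop :=
  forall G : subgraph (Kbip m n),
    contains_copy G H1 \/ contains_copy (rel_compl G) H2.

(* BR_m(H1, H2) = n.  It is a relation because, for some m, H1 and H2, no n
   has the arrowing property and BR_m(H1, H2) does not exist. *)
Definition is_BR (m : nat) (H1 H2 : sgraph) (n : nat) : Prop :=
  [/\ 0 < n, BR_arrows m H1 H2 n
    & forall k, 0 < k -> BR_arrows m H1 H2 k -> n <= k].

(* Main.v *)
Require Import Defs.
From mathcomp Require Import all_boot.
Set Implicit Arguments.
Unset Strict Implicit.
Unset Printing Implicit Defensive.

(** A bipartite graph with parts [5] and [n] is a family of [n] subsets of [5],
    the neighbourhoods of the columns. It is K_{2,2}-free iff every pair of rows
    lies in at most one of these sets, and its bipartite complement is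
    K_{4,4}-free iff for every row [i] at most three of them are contained in
    [{i}]. So at most [5 * 3] columns have degree at most one and at most
    ['C(5, 2) = 10] have degree at least two; the bound 25 is attained by taking
    every singleton three times and every pair once. *)

(** A copy may swap the two sides of the host. By adjacency, the side of the image of [inl ord0]
    fixes the sides of all other images, and the swapped case is harmless because both parts of the
    copy have size [p.+1]. *)
Lemma contains_KbipP m n p (G : subgraph (Kbip m n)) :
  contains_copy G (Kbip p.+1 p.+1) <->
  exists r : 'I_p.+1 -> 'I_m, exists c : 'I_p.+1 -> 'I_n,
    [/\ injective r, injective c
      & forall i j, sub_adj G (inl (r i)) (inr (c j))].
Proof.
split=> [[f f_inj f_adj] | [r [c [r_inj c_inj rc]]]]; last first.
  exists (fun x => match x with inl i => inl (r i) | inr j => inr (c j) end).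
    by case=> i [] j // []; [move/r_inj-> | move/c_inj->].
  by case=> i [] j //= _; rewrite // sub_adj_sym.
have fE i j : sub_adj G (f (inl i)) (f (inr j)) by apply: f_adj.
have fK i j : Kbip_adj (f (inl i)) (f (inr j)) by apply: (sub_adjW (fE i j)).
have inlI : injective (fun i => f (inl i)) by move=> i j /f_inj[].
have inrI : injective (fun i => f (inr i)) by move=> i j /f_inj[].
have [r1 [c1 _]] : exists _ : 'I_m, exists _ : 'I_n, True.
  by move: (fK ord0 ord0); case: (f _) (f _) => x [] y //.
(* The defaults [r1] and [c1] come from the two ends of one edge; [rowK] and [colK] below show that
   they are never reached. *)
pose row (x : 'I_m + 'I_n) := if x is inl i then i else r1.
pose col (x : 'I_m + 'I_n) := if x is inr j then j else c1.
case f0: (f (inl ord0)) => [r0 | c0].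
- have rowK j : f (inr j) = inr (col (f (inr j))).
    by move: (fK ord0 j); rewrite f0; case: (f (inr j)).
  have colK i : f (inl i) = inl (row (f (inl i))).
    by move: (fK i ord0); rewrite rowK; case: (f (inl i)).
  exists (fun i => row (f (inl i))), (fun j => col (f (inr j))).
  split=> [i j eq_ij | i j eq_ij | i j]; last by rewrite -colK -rowK.
    by apply: inlI; rewrite /= colK [RHS]colK eq_ij.
  by apply: inrI; rewrite /= rowK [RHS]rowK eq_ij.
- have rowK j : f (inr j) = inl (row (f (inr j))).
    by move: (fK ord0 j); rewrite f0; case: (f (inr j)).
  have colK i : f (inl i) = inr (col (f (inl i))).
    by move: (fK i ord0); rewrite rowK; case: (f (inl i)).
  exists (fun i => row (f (inr i))), (fun j => col (f (inl j))).
  split=> [i j eq_ij | i j eq_ij | i j]; last by rewrite -colK -rowK sub_adj_sym.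
    by apply: inrI; rewrite /= rowK [RHS]rowK eq_ij.
  by apply: inlI; rewrite /= colK [RHS]colK eq_ij.
Qed.

Lemma set_family_pigeonhole (I T : finType) (N : T -> {set I}) q :
    0 < #|I| -> #|I| * q + 'C(#|I|, 2) < #|T| ->
  (exists i, q < #|[set j | N j \subset [set i]]|) \/
  (exists j1, exists2 j2, j1 != j2 & 1 < #|N j1 :&: N j2|).
Proof.
move=> /card_gt0P[i0 _] ltT.
case: (boolP [exists i, q < #|[set j | N j \subset [set i]]|]) => [/existsP|].
  by left.
rewrite negb_exists => /forallP small; right.
pose D := [set j | 1 < #|N j|].
have leDC : #|~: D| <= #|I| * q.
  have /subset_leq_card/leq_trans-> //:
      ~: D \subset \bigcup_i [set j | N j \subset [set i]].
    apply/subsetP=> j; rewrite !inE -leqNgt => le1.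
    suff [i Ni] : exists i, N j \subset [set i].
      by apply/bigcupP; exists i; rewrite ?inE.
    (* An empty set lies in every singleton, so any element [i0] serves. *)
    have [-> | [i iN]] := set_0Vmem (N j); first by exists i0; apply: sub0set.
    by exists i; rewrite subEproper eq_sym eqEcard sub1set iN cards1 le1.
  rewrite -sum_nat_const.
  elim/big_rec2: _ => [|i n U _ leU]; first by rewrite cards0.
  by rewrite (leq_trans (leq_card_setU _ _)) // leq_add // leqNgt small.
have ltD : 'C(#|I|, 2) < #|D|.
  rewrite -(ltn_add2l (#|I| * q)) (leq_trans ltT) //.
  by rewrite -(cardsC D) addnC leq_add2r.
pose g j := odflt set0 [pick A : {set I} | (A \subset N j) && (#|A| == 2)].
have gP j : j \in D -> (g j \subset N j) && (#|g j| == 2).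
  rewrite inE /g => /card_gt1P[x [y [xN yN xy]]].
  case: pickP => // /(_ [set x; y]).
  by rewrite cards2 xy subUset !sub1set xN yN.
case: (boolP (dinjectiveb g D)) => [/dinjectiveP g_inj | /dinjectivePn].
  move: ltD; rewrite ltnNge -card_draws -(card_in_imset g_inj).
  case/negP; apply/subset_leq_card/subsetP=> _ /imsetP[j /gP/andP[_ gj] ->].
  by rewrite inE.
case=> j1 /gP/andP[s1 /eqP g2] [j2]; rewrite inE /=.
case/andP=> ne /gP/andP[s2 _] eg.
exists j1, j2; first by rewrite eq_sym.
by rewrite -g2 subset_leq_card // subsetI s1 eg.
Qed.

Lemma leq_card_inj (A : finType) (D : {set A}) k :
  k <= #|D| -> exists2 f : 'I_k -> A, injective f & forall i, f i \in D.
Proof.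
move=> le; exists (fun i => enum_val (widen_ord le i)) => [i j | i].
  by move=> /enum_val_inj/(congr1 val)/= /val_inj.
exact: enum_valP.
Qed.

Lemma BR_arrows_5_26 : BR_arrows 5 (Kbip 2 2) (Kbip 4 4) 26.
Proof.
move=> G; pose N (j : 'I_26) := [set i : 'I_5 | sub_adj G (inl i) (inr j)].
have [I_gt0 lt25] : 0 < #|'I_5| /\ #|'I_5| * 3 + 'C(#|'I_5|, 2) < #|'I_26|.
  by rewrite !card_ord.
have [[i /leq_card_inj[c c_inj cP]] | [j1 [j2 ne /leq_card_inj[r r_inj rP]]]] :=
  set_family_pigeonhole N I_gt0 lt25.
(* Four columns with neighbourhoods inside [[set i]] miss the other four rows, which [lift i]
   enumerates. *)
- right; apply/contains_KbipP; exists (lift i), c; split=> //.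
    exact: lift_inj.
  move=> k j; rewrite /= /compl_adj /=; apply/negP=> kj.
  move: (cP j); rewrite inE => /subsetP/(_ (lift i k)).
  by rewrite !inE kj eq_sym (negPf (neq_lift _ _)) => /(_ isT).
- left; apply/contains_KbipP.
  exists r, (fun j => if j == ord0 then j1 else j2); split=> //.
    move=> [[|[|i]] lt_i] [[|[|j]] lt_j] //= eq_j;
      try exact: val_inj.
      by rewrite eq_j eqxx in ne.
    by rewrite eq_j eqxx in ne.
  by move=> i j; move: (rP i); rewrite !inE => /andP[? ?]; case: ifP.
Qed.

(* Columns 0-4 and 5-9 are the pairs of residues mod 5 at distance 1 and 2;
   columns 10-24 are three copies of each singleton. *)
Definition extremal_edge (i j : nat) : bool :=
  [|| i == j %% 5, (j < 5) && (i == j.+1 %% 5)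
    | (5 <= j < 10) && (i == j.+2 %% 5)].

Definition extremal_adj n : rel ('I_5 + 'I_n) := fun x y =>
  match x, y with
  | inl i, inr j | inr j, inl i => extremal_edge i j
  | _, _ => false
  end.

Lemma extremal_adj_sym n : symmetric (@extremal_adj n).
Proof. by case=> ? []. Qed.

Lemma extremal_adjW n : subrel (@extremal_adj n) (@adj (Kbip 5 n)).
Proof. by case=> ? []. Qed.

Definition extremal_graph n : subgraph (Kbip 5 n) :=
  @Subgraph (Kbip 5 n) _ (@extremal_adj_sym n) (@extremal_adjW n).

(** The iterate lists all words over [A] of the length of [s], which turns a quantifier over tuples
    of rows into a computation. *)
Lemma mem_words (T : eqType) (A s : seq T) : {subset s <= A} ->
  s \in iter (size s) (fun W => [seq a :: w | a <- A, w <- W]) [:: [::]].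
Proof.
elim: s => [|a s IHs] // sA; rewrite iterS; apply: allpairs_f.
  by apply: sA; rewrite mem_head.
by apply: IHs => b bs; apply: sA; rewrite inE bs orbT.
Qed.

(** Only tuples of rows are enumerated; for each one, the common neighbours among the first [k]
    columns are counted. Since [n <= k], one check at [k] settles every smaller number of
    columns. *)
Lemma no_biclique (e : rel nat) m n k p (r : 'I_p -> 'I_m) (c : 'I_p -> 'I_n) :
    n <= k -> injective r -> injective c ->
    all (fun s => uniq s ==> (size [seq j <- iota 0 k | all (e^~ j) s] < p))
      (iter p (fun W => [seq a :: w | a <- iota 0 m, w <- W]) [:: [::]]) ->
  ~ forall i j, e (r i) (c j).
Proof.
move=> le_nk r_inj c_inj check rc.
pose s := map (fun i => r i : nat) (enum 'I_p).
have s_uniq : uniq s by rewrite map_inj_uniq ?enum_uniq // => i j /val_inj/r_inj.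
have /mem_words : {subset s <= iota 0 m}.
  by move=> _ /mapP[i _ ->]; rewrite mem_iota /=.
rewrite size_map size_enum_ord => /(allP check); rewrite s_uniq ltnNge /=.
case/negP; rewrite -[p in p <= _](size_enum_ord p).
rewrite -(size_map (fun j => c j : nat)); apply: uniq_leq_size.
  by rewrite map_inj_uniq ?enum_uniq // => i j /val_inj/c_inj.
move=> _ /mapP[j _ ->]; rewrite mem_filter mem_iota /= (leq_trans _ le_nk) //.
by rewrite andbT; apply/allP=> _ /mapP[i _ ->].
Qed.

Lemma extremal_graph_avoids n : n <= 25 ->
  ~ (contains_copy (extremal_graph n) (Kbip 2 2) \/
     contains_copy (rel_compl (extremal_graph n)) (Kbip 4 4)).
Proof.
move=> le_n; case=> /contains_KbipP[r [c [r_inj c_inj rc]]].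
  (* Here [k] is 25 and the computation runs over the 5^2 words of rows; for the complement below it
     runs over 5^4. *)
  by apply: (@no_biclique extremal_edge _ _ _ _ r c le_n) => //; vm_compute.
by apply: (@no_biclique (fun i j => ~~ extremal_edge i j) _ _ _ _ r c le_n) => //;
   vm_compute.
Qed.

Theorem theorem3 : is_BR 5 (Kbip 2 2) (Kbip 4 4) 26.
Proof.
split=> [//||k _ arrows]; first exact: BR_arrows_5_26.
(* [26 <= k] is by definition [25 < k], whose negation is the bound [k <= 25] that the extremal
   graph requires. *)
by rewrite ltnNge; apply/negP=> /extremal_graph_avoids; apply; apply: arrows.
Qed.
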